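(* For every BO-EADARP instance, the Fragment-Based Checker algorithm is guaranteed to find all non-dominated points, i.e. every point of the Pareto frontier $\mathcal Y_N=\{z(x):x\in\mathcal X_E\}$ of the instance.
   Context: **Instance of the bi-objective electric autonomous dial-a-ride problem (BO-EADARP).** A complete directed graph $G=(V,A)$, $A=\{(i,j): i,j\in V, i\ne j\}$, with $V=N\cup S\cup O\cup F$ finite: $N=P\cup D$, pickups $P=\{1,\dots,n\}$ (also the set of requests/users), drop-offs $D=\{n+1,\dots,2n\}$ (request $i$ has pickup $i$ and drop-off $n+i$), recharging stations $S$, origin depots $O$, destination depots $F$. A finite set $K$ of homogeneous vehicles with seat capacity $C$ and battery capacity $Q$; $|O|=|K|$, $|F|\ge|O|$, vehicle $k$ has origin depot $o^k$ and initial battery level $B_0^k$. Each request $i$ has maximum ride time $m_i$; each node $i\in V$ has a time window $[e_i,l_i]$, load $q_i$ and service duration $s_i$, with $q_i>0$ for $i\in P$, $q_{n+i}=-q_i$, and $q_j=s_j=0$ for $j\in O\cup F\cup S$. Travel times $t_{i,j}$ and battery consumptions $b_{i,j}$ on arcs satisfy the triangle inequality. The recharging rate is $\alpha$; $\gamma Q$ is the minimum battery level at destination depots. Partial recharging is allowed. **Constraints.** Binary variables $x_{i,j}^k$ (vehicle $k$ uses arc $(i,j)$); continuous variables $T_i^k$ (start of service), $L_i^k$ (load), $B_i^k\ge0$ (battery level), $E_s^k\ge0$ (recharging time at $s\in S$), $R_i$ (excess ride time of request $i$). The constraints are: - $\sum_{j\in P\cup S\cup F}x_{o^k,j}^k=1$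 and $\sum_{i\in D\cup S\cup\{o^k\}}\sum_{j\in F}x_{i,j}^k=1$ for all $k\in K$; - $\sum_{k}\sum_{i\in D\cup S\cup\{o^k\}}x_{i,j}^k\le1$ for $j\in F\cup S$; - $\sum_{j\ne i}x_{i,j}^k=\sum_{j\ne i}x_{j,i}^k$ for $k\in K$, $i\in N\cup S$; - $\sum_k\sum_{j\in N,j\ne i}x_{i,j}^k=1$ for $i\in P$; - $\sum_{j\in N,j\ne i}x_{i,j}^k=\sum_{j\in N,j\ne n+i}x_{j,n+i}^k$ for $k\in K$, $i\in P$; - $T_i^k+s_i+t_{i,n+i}\le T_{n+i}^k$, $\ T_{n+i}^k-T_i^k-s_i\le m_i$, $\ R_i\ge T_{n+i}^k-T_i^k-s_i-t_{i,n+i}$ for $k\in K$, $i\in P$; - $e_i\le T_i^k\le l_i$ for $k\in K$, $i\in V$; - if $x_{i,j}^k=1$: $T_i^k+t_{i,j}+s_i\le T_j^k$ and $L_j^k=L_i^k+q_j$; - $\max\{0,q_i\}\le L_i^k\le\min\{C,C+q_i\}$ for $i\in N$; $L_i^k=0$ for $i\in\{o^k\}\cup F\cup S$; - $B_{o^k}^k=B_0^k$; if $x_{i,j}^k=1$ with $i\in V\setminus S$, $j\in V\setminus\{o^k\}$: $B_j^k=B_i^k-b_{i,j}$; if $x_{s,j}^k=1$ with $s\in S$, $j\in P\cup F\cup S$: $B_j^k=B_s^k+\alpha E_s^k-b_{s,j}$ and $E_s^k=T_j^k-t_{s,j}-T_s^k$; - $B_s^k+\alpha E_s^k\le Q$ for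 $s\in S$; $B_i^k\ge\gamma Q$ for $i\in F$. (The conditional constraints are modelled in the MILP by big-M terms.) **Objectives and efficiency.** Minimize $z_1=\sum_{k\in K}\sum_{(i,j)\in A}t_{i,j}x_{i,j}^k$ (total travel time) and $z_2=\sum_{i\in P}R_i$ (total excess user ride time). A feasible solution $x$ is identified with its set of routes; $z_2(x)$ is the minimum total excess user ride time over feasible schedules of these routes. $\mathcal X$ is the set of feasible solutions (assumed nonempty), $z(x)=(z_1(x),z_2(x))$. A point $z$ dominates $z'$ if $z_1\le z'_1$ and $z_2\le z'_2$ with at least one strict inequality. $x^*\in\mathcal X$ is efficient if no $x\in\mathcal X$ has $z(x)$ dominating $z(x^* )$; then $z(x^* )$ is a non-dominated point. $\mathcal X_E$ is the set of efficient solutions and $\mathcal Y_N=\{z(x):x\in\mathcal X_E\}$. $\operatorname{lexmin}_{x\in\mathcal X}\{z_i(x),z_j(x)\}$ means minimizing $z_j$ among all minimizers of $z_i$ over $\mathcal X$. **Battery-restricted fragments.** A battery-restricted fragment (fragment, for short) is a sequence $(i_1,\dots,i_k)$ of pickup and drop-off nodes such that the vehicle arrives empty at $i_1$, leaves empty at $i_k$, and has passengers on board at the other nodes, and such that there is a feasible route $(o,s_{i_1},\dots,s_{i_v},i_1,\dots,i_k,s_{i_{v+1}},\dots,s_{i_m},f)$ with $o\in O$, $f\in F$ and recharging stations $s_{i_j}\in S$ (possibly none). Let $\mathcal F$ be the finite set of all fragments; for $f\in\mathcal F$, $T_f$ is its travel time, $R_f$ its minimum excess user ride time, and $a_{i,f}=1$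 if request $i$ is in $f$, else $0$. Standing facts from earlier work (Su, Dupin and Puchinger, 2023): every feasible route is a concatenation of fragments, recharging stations (if any), an origin depot and a destination depot; and for a feasible solution $x$, $z_2(x)$ equals the sum of $R_f$ over the fragments $f$ composing $x$. **Regions.** For $z^t=(y_1^t,y_2^t)$ and $z^b=(y_1^b,y_2^b)$, $R(z^t,z^b)=\{(z_1,z_2)\mid 0\le z_1<y_1^b,\ y_2^b\le z_2<y_2^t\}$. **Select-and-Check (SaC) algorithm**, input $R(z^t,z^b)$. Start with $\Xi=\emptyset$ and repeat: *Step 1 (select).* Solve $$\min\sum_{f\in\mathcal F}T_fx_f\quad\text{s.t.}\quad \sum_{f\in\mathcal F}a_{i,f}x_f=1\ (i\in P),\quad y_2^b\le\sum_{f\in\mathcal F}R_fx_f<y_2^t,\quad \sum_{f\in\xi}x_f\le|\xi|-1\ (\xi\in\Xi),\quad x_f\in\{0,1\}.$$ If infeasible, stop: no solution is found. Otherwise let $\xi$ be the set of fragments selected. *Step 2 (check).* Fix to $1$ the arc variables of all arcs inside the fragments in $\xi$ and solve the BO-EADARP constraints above minimizing $z_1$. If a solution $x$ exists and $z_1(x)<y_1^b$, stop and return $x$. Otherwise add $\xi$ to $\Xi$ and return to Step 1. **Fragment-Based Checker algorithm.** 1. Compute $x^T\in\operatorname{lexmin}_{x\in\mathcal X}\{z_1(x),z_2(x)\}$ and $x^B\in\operatorname{lexmin}_{x\in\mathcal X}\{z_2(x),z_1(x)\}$; set $z^T=z(x^T)$, $z^B=z(x^B)$, the ordered list $Rec=[R(z^T,z^B)]$,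 and the candidate set $\mathcal C=\{x^T,x^B\}$. 2. While $Rec\neq\emptyset$: extract and remove the last element $R(z^t,z^b)$ of $Rec$ and apply SaC to it. If SaC finds no solution, go to the next while iteration. If SaC returns $x^{new}$, add $x^{new}$ to $\mathcal C$, put $z^{new}=z(x^{new})$, and: - (a) if $z^t=z^T$, append $R(z^T,z^{new})$ and then $R(z^{new},z^b)$ to $Rec$, and go to the next while iteration; - (b) otherwise, go through the elements $R(\bar z^t,\bar z^b)$ of $Rec$ from end to beginning: if $z^{new}$ dominates $\bar z^t$, remove $R(\bar z^t,\bar z^b)$ from $Rec$ and continue with the next element; else if $z^{new}$ dominates $\bar z^b$, replace $R(\bar z^t,\bar z^b)$ by $R(\bar z^t,z^{new})$ in $Rec$, append $R(z^{new},z^b)$ to the end of $Rec$, and leave this loop; else append $R(\bar z^t,z^{new})$ and then $R(z^{new},z^b)$ to the end of $Rec$, and leave this loop. 3. Remove the dominated solutions from $\mathcal C$; return the remaining solutions and their images. *)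

(* Defs.v *)
From HB Require Import structures.
From mathcomp Require Import all_boot all_order all_algebra.
From mathcomp Require Import all_classical all_reals.

Set Implicit Arguments.
Unset Strict Implicit.
Unset Printing Implicit Defensive.

Import Order.TTheory GRing.Theory Num.Theory.
Local Open Scope ring_scope.

(* V = P + D + S + O + F.  Requests are 'I_n; request i has pickup [pick i]   *)
(* and drop-off [drop i] (the nodes i and n+i of the mathematical notation).  *)
Inductive node (n : nat) (S O F : Type) : Type :=
  | pick of 'I_n | drop of 'I_n | station of S | orig of O | dest of F.
Arguments pick {n S O F}.
Arguments drop {n S O F}.
Arguments station {n S O F}.
Arguments orig {n S O F}.
Arguments dest {n S O F}.

Section NodeFinite.
Variables (n : nat) (S O F : finType).

Definition node_enc (v : node n S O F) : 'I_n + 'I_n + (S + (O + F)) :=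
  match v with
  | pick i => inl (inl i) | drop i => inl (inr i)
  | station s => inr (inl s)
  | orig o => inr (inr (inl o)) | dest f => inr (inr (inr f))
  end.

Definition node_dec (u : 'I_n + 'I_n + (S + (O + F))) : node n S O F :=
  match u with
  | inl (inl i) => pick i | inl (inr i) => drop i
  | inr (inl s) => station s
  | inr (inr (inl o)) => orig o | inr (inr (inr f)) => dest f
  end.

Lemma node_encK : cancel node_enc node_dec.
Proof. by case. Qed.

HB.instance Definition _ := Equality.copy (node n S O F) (can_type node_encK).
HB.instance Definition _ := Choice.copy (node n S O F) (can_type node_encK).
HB.instance Definition _ := Countable.copy (node n S O F) (can_type node_encK).
HB.instance Definition _ := Finite.copy (node n S O F) (can_type node_encK).
End NodeFinite.

(* The travel times and consumptions are only meaningful on the arcs (i, j),  *)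
(* i != j.  The map [origin_of] sends k to o^k.                               *)
Record instance (R : realType) := Instance {
  nreq : nat;
  station_t : finType;
  origin_t : finType;
  dest_t : finType;
  vehicle : finType;
  origin_of : vehicle -> origin_t;
  seats : R;                                     (* C *)
  battery : R;                                   (* Q *)
  init_battery : vehicle -> R;                   (* B_0^k *)
  charge_rate : R;                               (* alpha *)
  min_level : R;                                 (* gamma *)
  max_ride : 'I_nreq -> R;                       (* m_i *)
  tw_open : node nreq station_t origin_t dest_t -> R;    (* e_i *)
  tw_close : node nreq station_t origin_t dest_t -> R;   (* l_i *)
  load : node nreq station_t origin_t dest_t -> R;       (* q_i *)
  service : node nreq station_t origin_t dest_t -> R;    (* s_i *)
  travel : node nreq station_t origin_t dest_t ->
           node nreq station_t origin_t dest_t -> R;     (* t_ij *)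
  consum : node nreq station_t origin_t dest_t ->
           node nreq station_t origin_t dest_t -> R;     (* b_ij *)
  card_origin : #|origin_t| = #|vehicle|;
  card_dest : (#|origin_t| <= #|dest_t|)%N;
  load_pick : forall i, 0 < load (pick i);
  load_drop : forall i, load (drop i) = - load (pick i);
  load_station : forall s, load (station s) = 0 /\ service (station s) = 0;
  load_orig : forall o, load (orig o) = 0 /\ service (orig o) = 0;
  load_dest : forall f, load (dest f) = 0 /\ service (dest f) = 0;
  travel_triangle : forall i j k, i != j -> j != k -> i != k ->
    travel i k <= travel i j + travel j k;
  consum_triangle : forall i j k, i != j -> j != k -> i != k ->
    consum i k <= consum i j + consum j k
}.

Section BOEADARP.
Variables (R : realType) (I : instance R).

Definition V : Type := node (nreq I) (station_t I) (origin_t I) (dest_t I).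
HB.instance Definition _ := Finite.on V.

Local Notation K := (vehicle I).
Local Notation req := 'I_(nreq I).
Local Notation q := (@load R I).
Local Notation serv := (@service R I).
Local Notation t := (@travel R I).
Local Notation b := (@consum R I).
Local Notation C := (seats I).
Local Notation Q := (battery I).
Local Notation alpha := (charge_rate I).

Definition start (k : K) : V := orig (origin_of k).

Definition Pset : {set V} := [set v | if v is pick _ then true else false].
Definition Dset : {set V} := [set v | if v is drop _ then true else false].
Definition Sset : {set V} := [set v | if v is station _ then true else false].
Definition Fset : {set V} := [set v | if v is dest _ then true else false].
Definition Nset : {set V} := Pset :|: Dset.

Definition arcs (r : seq V) : seq (V * V) := zip r (behead r).

(* Constraints on one vehicle k; [y] are its arc variables (x_ij^k)_(i,j).    *)
(* Following the model, T, L, B are constrained at every node, visited or     *)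
(* not; the values at unvisited nodes are linked to no arc.                   *)

Definition flow_ok (k : K) (y : V -> V -> bool) : Prop :=
  [/\ (\sum_(j in Pset :|: Sset :|: Fset) y (start k) j = 1)%N,
      (\sum_(i in Dset :|: Sset :|: [set start k]) \sum_(j in Fset) y i j
         = 1)%N,
      forall i, i \in Nset :|: Sset ->
        (\sum_(j | j != i) y i j = \sum_(j | j != i) y j i)%N
    & forall i : req,
        (\sum_(j in Nset | j != pick i) y (pick i) j
         = \sum_(j in Nset | j != drop i) y j (drop i))%N].

Definition time_ok (y : V -> V -> bool) (T : V -> R) : Prop :=
  [/\ forall i : req,
        T (pick i) + serv (pick i) + t (pick i) (drop i) <= T (drop i),
      forall i : req, T (drop i) - T (pick i) - serv (pick i) <= max_ride i,
      forall i : V, tw_open i <= T i <= tw_close i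
    & forall i j : V, y i j -> T i + t i j + serv i <= T j].

Definition load_ok (k : K) (y : V -> V -> bool) (L : V -> R) : Prop :=
  [/\ forall i j : V, y i j -> L j = L i + q j,
      forall i, i \in Nset -> Num.max 0 (q i) <= L i <= Num.min C (C + q i)
    & forall i, i \in start k |: (Fset :|: Sset) -> L i = 0].

Definition battery_ok (k : K) (y : V -> V -> bool) (T B : V -> R)
    (E : station_t I -> R) : Prop :=
  [/\ (forall i, 0 <= B i) /\ (forall s, 0 <= E s),
      B (start k) = init_battery k,
      forall i j : V, y i j -> i \notin Sset -> j != start k ->
        B j = B i - b i j,
      forall (s : station_t I) (j : V), y (station s) j ->
        j \in Pset :|: Fset :|: Sset ->
        B j = B (station s) + alpha * E s - b (station s) j
        /\ E s = T j - t (station s) j - T (station s)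
    & (forall s, B (station s) + alpha * E s <= Q)
      /\ (forall i, i \in Fset -> min_level I * Q <= B i)].

Definition vehicle_ok (k : K) (y : V -> V -> bool) (T L B : V -> R)
    (E : station_t I -> R) : Prop :=
  [/\ flow_ok k y, time_ok y T, load_ok k y L & battery_ok k y T B E].

Definition is_route (k : K) (r : seq V) : Prop :=
  exists (mid : seq V) (f : dest_t I),
    [/\ r = start k :: rcons mid (dest f),
        {subset mid <= Nset :|: Sset} & uniq r].

(* A route of vehicle k that is feasible on its own; it may serve only some   *)
(* of the requests.                                                           *)
Definition feasible_route (k : K) (r : seq V) : Prop :=
  is_route k r /\
  exists (T L B : V -> R) (E : station_t I -> R),
    vehicle_ok k (fun i j => (i, j) \in arcs r) T L B E.

(* The binary variables: x (k, i, j) is x_ij^k. *)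
Definition solution : finType := {ffun K * V * V -> bool}.

Implicit Types x : solution.

Definition route_of x (k : K) (r : seq V) : Prop :=
  is_route k r /\ forall i j, x (k, i, j) = ((i, j) \in arcs r).

Definition schedule_ok x (T L B : K -> V -> R) (E : K -> station_t I -> R)
    (Rx : req -> R) : Prop :=
  [/\ forall k, vehicle_ok k (fun i j => x (k, i, j)) (T k) (L k) (B k) (E k),
      forall j, j \in Fset :|: Sset ->
        (\sum_k \sum_(i in Dset :|: Sset :|: [set start k]) x (k, i, j)
           <= 1)%N,
      forall i : req,
        (\sum_k \sum_(j in Nset | j != pick i) x (k, pick i, j) = 1)%N
    & forall (k : K) (i : req),
        T k (drop i) - T k (pick i) - serv (pick i) - t (pick i) (drop i)
          <= Rx i].

(* A solution is identified with its set of routes, one per vehicle: the arc  *)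
(* variables are required to describe such routes.  (The constraints alone    *)
(* admit spurious extra components, e.g. a cycle through nodes at mutual      *)
(* distance 0, or a path between depots of other vehicles.)                   *)
Definition feasible x : Prop :=
  (forall k, exists r, route_of x k r)
  /\ exists T L B E Rx, schedule_ok x T L B E Rx.

Definition z1 x : R := \sum_k \sum_i \sum_(j | j != i) t i j * (x (k, i, j))%:R.

(* The infima in [z2] and [frag_excess] are minima: the sets are projections  *)
(* of closed polyhedra, and are bounded below by 0.                           *)
Definition z2 x : R :=
  inf [set v : R | exists T L B E Rx,
         schedule_ok x T L B E Rx /\ v = \sum_i Rx i].

Definition point : Type := (R * R)%type.
Definition z x : point := (z1 x, z2 x).

Definition dominates (u v : point) : bool :=
  [&& u.1 <= v.1, u.2 <= v.2 & (u.1 < v.1) || (u.2 < v.2)].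

Definition efficient x : Prop :=
  feasible x /\ ~ exists2 x', feasible x' & dominates (z x') (z x).

Definition pareto_frontier : set point := [set z x | x in efficient].

Definition minimizer (A : solution -> Prop) (g : solution -> R) x : Prop :=
  A x /\ forall x', A x' -> g x <= g x'.

Definition lexmin (g h : solution -> R) x : Prop :=
  minimizer (minimizer feasible g) h x.

Definition load_after (g : seq V) (j : nat) : R := \sum_(v <- take j g) q v.

(* The vehicle reaches the first node empty, has passengers on board from     *)
(* then on, and is empty again exactly after the last node.                   *)
Definition fragment_loads (g : seq V) : Prop :=
  [/\ g != [::], {subset g <= Nset},
      forall j, (0 < j < size g)%N -> 0 < load_after g j
    & load_after g (size g) = 0].

Definition is_fragment (g : seq V) : Prop :=
  fragment_loads g /\
  exists (k : K) (s1 s2 : seq (station_t I)) (f : dest_t I),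
    feasible_route k
      (start k :: map station s1 ++ g ++ map station s2 ++ [:: dest f]).

(* Nodes are not repeated in a fragment, so length #|V| suffices. *)
Definition frag : finType := {bseq #|{: V}| of V}.

Definition fragments : {set frag} := [set f : frag | `[< is_fragment f >]].

Definition frag_time (f : frag) : R := \sum_(a <- arcs f) t a.1 a.2.

Definition in_frag (i : req) (f : frag) : bool := pick i \in (f : seq V).

Definition frag_schedule (f : frag) (T : V -> R) : Prop :=
  [/\ forall v, v \in (f : seq V) -> tw_open v <= T v <= tw_close v,
      forall i j, (i, j) \in arcs f -> T i + t i j + serv i <= T j
    & forall i : req, in_frag i f ->
        T (pick i) + serv (pick i) + t (pick i) (drop i) <= T (drop i)
        /\ T (drop i) - T (pick i) - serv (pick i) <= max_ride i].

Definition frag_excess (f : frag) : R :=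
  inf [set v : R | exists2 T, frag_schedule f T &
         v = \sum_(i : req | in_frag i f)
               (T (drop i) - T (pick i) - serv (pick i)
                - t (pick i) (drop i))].

Definition concatenation (k : K) (r : seq V) (bs : seq (seq V)) : Prop :=
  (exists f : dest_t I, r = start k :: rcons (flatten bs) (dest f)) /\
  forall g, g \in bs ->
    is_fragment g \/ exists s : station_t I, g = [:: station s].

Definition composes (f : frag) x : Prop :=
  is_fragment f /\
  exists k r bs,
    [/\ route_of x k r, concatenation k r bs & (f : seq V) \in bs].

(* The two standing facts on fragments (Su, Dupin and Puchinger, 2023).  They *)
(* are properties of the instance: since E_s^k = T_j^k - t_sj - T_s^k forbids *)
(* idling after a recharge, artificial time windows or battery data can       *)
(* violate them.                                                              *)
Definition routes_are_concatenations : Prop :=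
  forall k r, feasible_route k r -> exists bs, concatenation k r bs.

Definition excess_is_additive : Prop :=
  forall x, feasible x ->
    z2 x = \sum_(f : frag | `[< composes f x >]) frag_excess f.

(* The region R(z^t, z^b) = { u | 0 <= u.1 < z^b.1, z^b.2 <= u.2 < z^t.2 } is *)
(* represented by the pair (z^t, z^b).                                        *)
Definition region : Type := (point * point)%type.

(* Step 1 of Select-and-Check; xi is the set of f with x_f = 1. *)
Definition select_feasible (rg : region) (Xi : {set {set frag}})
    (xi : {set frag}) : Prop :=
  [/\ xi \subset fragments,
      forall i : req, (\sum_(f in fragments) in_frag i f * (f \in xi) = 1)%N,
      rg.2.2 <= \sum_(f in fragments) frag_excess f * (f \in xi)%:R < rg.1.2
    & forall xi', xi' \in Xi ->
        \sum_(f in xi') (f \in xi)%:R <= #|xi'|%:R - 1 :> R].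

Definition frags_time (xi : {set frag}) : R :=
  \sum_(f in fragments) frag_time f * (f \in xi)%:R.

Definition select_optimal rg Xi xi : Prop :=
  select_feasible rg Xi xi /\
  forall xi', select_feasible rg Xi xi' -> frags_time xi <= frags_time xi'.

(* Step 2: feasible solutions using every arc inside the fragments of xi. *)
Definition check_feasible (xi : {set frag}) x : Prop :=
  feasible x /\
  forall (f : frag) i j, f \in xi -> (i, j) \in arcs f ->
    exists k, x (k, i, j).

Definition check_success (rg : region) xi x : Prop :=
  minimizer (check_feasible xi) z1 x /\ z1 x < rg.2.1.

(* Case (b), on the list Rec in reverse order (last element first). *)
Fixpoint scan (znew zb : point) (rev_rec : seq region) : seq region :=
  match rev_rec with
  | [::] => [::]
  | (bt, bb) :: rest =>
      if dominates znew bt then scan znew zb rest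
      else if dominates znew bb then [:: (znew, zb), (bt, znew) & rest]
      else [:: (znew, zb), (bt, znew), (bt, bb) & rest]
  end.

Definition update (zT : point) (rg : region) (znew : point)
    (rec : seq region) : seq region :=
  if rg.1 == zT then rec ++ [:: (zT, znew); (znew, rg.2)]
  else rev (scan znew rg.2 (rev rec)).

Definition nondominated_part (cand : {set solution}) : {set solution} :=
  [set x in cand | ~~ [exists x' in cand, dominates (z x') (z x)]].

(* Control points of the Fragment-Based Checker: before step 1; at the test   *)
(* of the while loop; in Select-and-Check, before its step 1 and before its   *)
(* step 2; after returning.  [rg] is the region being searched.               *)
Inductive config : Type :=
  | Start
  | Loop (zT : point) (rec : seq region) (cand : {set solution})
  | Select (zT : point) (rec : seq region) (cand : {set solution})
      (rg : region) (Xi : {set {set frag}})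
  | Check (zT : point) (rec : seq region) (cand : {set solution})
      (rg : region) (Xi : {set {set frag}}) (xi : {set frag})
  | Return (cand : {set solution}).

(* The relation is nondeterministic: ties between optimal solutions of the    *)
(* subproblems are broken arbitrarily.                                        *)
Inductive step : config -> config -> Prop :=
  | step_init xT xB of lexmin z1 z2 xT & lexmin z2 z1 xB :
      step Start (Loop (z xT) [:: (z xT, z xB)] [set xT; xB])
  | step_extract zT rec rg cand :
      step (Loop zT (rcons rec rg) cand) (Select zT rec cand rg finset.set0)
  | step_return zT cand :
      step (Loop zT [::] cand) (Return (nondominated_part cand))
  | step_select zT rec cand rg Xi xi of select_optimal rg Xi xi :
      step (Select zT rec cand rg Xi) (Check zT rec cand rg Xi xi)
  | step_none zT rec cand rg Xi of ~ (exists xi, select_feasible rg Xi xi) :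
      step (Select zT rec cand rg Xi) (Loop zT rec cand)
  | step_found zT rec cand rg Xi xi x of check_success rg xi x :
      step (Check zT rec cand rg Xi xi)
           (Loop zT (update zT rg (z x) rec) (x |: cand)%SET)
  | step_reject zT rec cand rg Xi xi of ~ (exists x, check_success rg xi x) :
      step (Check zT rec cand rg Xi xi)
           (Select zT rec cand rg (xi |: Xi)%SET).

(* Every execution from c, whatever the choices, reaches after finitely many  *)
(* steps and without getting stuck a configuration satisfying G.              *)
Inductive guaranteed (G : config -> Prop) (c : config) : Prop :=
  | guaranteed_now of G c
  | guaranteed_later of (exists c', step c c')
      & (forall c', step c c' -> guaranteed G c').

Definition returns_all_nondominated (c : config) : Prop :=
  exists2 out, c = Return out &
    forall y, pareto_frontier y -> exists2 x, x \in out & z x = y.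

End BOEADARP.

(* Main.v *)
(* Loads cut a route into fragments in only one way, so a feasible solution   *)
(* using all arcs of a family of fragments that serves each request once is   *)
(* composed of exactly that family.  Hence Select-and-Check finds a solution  *)
(* with image in the region as soon as one exists: the composition of such a  *)
(* solution is never cut off, because a cut only excludes supersets of a      *)
(* rejected family and two families serving each request once are not         *)
(* strictly nested.                                                           *)
(* In the main loop every region of Rec but the last has top zT, which no     *)
(* feasible point dominates; so the removal in case (b) never happens, and    *)
(* every non-dominated point stays in the candidate set or in a region.       *)

Require Import Defs.
From mathcomp Require Import all_boot all_order all_algebra.
From mathcomp Require Import all_classical all_reals.
(* Again, since MathComp shadows the constructors pick and drop. *)
Import Defs.

Set Implicit Arguments.
Unset Strict Implicit.
Unset Printing Implicit Defensive.

Import Order.TTheory GRing.Theory Num.Theory.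
Local Open Scope ring_scope.

(** A fragment is empty exactly at its two ends, so a route splits into fragments and stations in
    only one way ([blocks_inj]). Hence a feasible solution using all arcs of a family of fragments
    that serves each request once is composed of exactly that family ([check_feasible_composes]),
    and by additivity its excess ride time is the sum bounded by the selection. Conversely, no cut
    excludes the composition of a feasible solution with image in the region
    ([composition_select_feasible]). So Select-and-Check terminates, and fails only on regions
    without feasible images ([guaranteed_select]).

    The main loop keeps every efficient image among the candidates or in a listed region
    ([covers_frontier_update]): an efficient image other than the new point is strictly better in
    one objective, hence stays in one of the two parts of a split. Only finitely many splits occur,
    as each replaces a region by two of smaller rank ([regions_weight_update]). When the list is
    empty, the candidates contain the whole frontier. *)

Lemma uniq_split_inj (T : eqType) (v : T) (a c b d : seq T) :
  uniq (a ++ v :: b) -> a ++ v :: b = c ++ v :: d -> a = c /\ b = d.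
Proof.
elim: a c => [|x a IHa] [|y c] //=.
- by move=> _ [].
- move=> /andP[vb _] [yv e]; subst y.
  by rewrite e mem_cat inE eqxx orbT in vb.
- move=> /andP[xa _] [xv e]; subst x.
  by rewrite mem_cat inE eqxx orbT in xa.
by move=> /andP[_ ua] [-> e]; have [-> ->] := IHa _ ua e.
Qed.

(** * Arcs of a node sequence *)

Section Arcs.
Variables (R : realType) (I : instance R).
Implicit Types (r s : seq (V I)) (u v : V I).

Lemma arcsP r u v :
  reflect (exists l1 l2, r = l1 ++ u :: v :: l2) ((u, v) \in arcs r).
Proof.
rewrite /arcs; elim: r => [|a [|b r] IHr].
- by constructor=> -[[|? ?] [? ?]].
- by constructor=> -[[|? [|? ?]] [? ?]].
rewrite /= inE; apply: (iffP orP).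
- case=> [/eqP[-> ->]|]; first by exists [::], r.
  by move/IHr => [l1 [l2 ->]]; exists (a :: l1), l2.
case=> [[|x l1] [l2]] /=; first by case=> -> -> _; left.
by case=> _ e; right; apply/IHr; exists l1, l2.
Qed.

Lemma arcs_mem r u v : (u, v) \in arcs r -> (u \in r) * (v \in r).
Proof. by case/arcsP=> [l1 [l2 ->]]; rewrite !(mem_cat, inE) !eqxx !orbT. Qed.

Lemma arcs_neq r u v : uniq r -> (u, v) \in arcs r -> u != v.
Proof.
move=> ur /arcsP[l1 [l2 e]]; apply: contraTneq ur => uv.
by rewrite e uv cat_uniq /= inE eqxx !andbF.
Qed.

Lemma arcs_infix s r r1 r2 : r = r1 ++ s ++ r2 -> {subset arcs s <= arcs r}.
Proof.
move=> -> [u v] /arcsP[l1 [l2 ->]]; apply/arcsP.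
by exists (r1 ++ l1), (l2 ++ r2); rewrite -!catA.
Qed.

(** In a duplicate-free sequence a node has at most one successor, so a chain of its arcs starting
    at [v] can only run along it. *)
Lemma arcs_follow a v w s : uniq (a ++ v :: w) ->
  {subset arcs (v :: s) <= arcs (a ++ v :: w)} -> exists w', w = s ++ w'.
Proof.
elim: s a v w => [|x s IHs] a v w ua sub; first by exists w.
have /arcsP[l1 [l2 e]] : (v, x) \in arcs (a ++ v :: w).
  by apply: sub; rewrite /arcs /= inE eqxx.
have [_ ew] := uniq_split_inj ua e; subst w.
have [||w' ->] := IHs (rcons a v) x l2; first by rewrite cat_rcons.
  by move=> y ys; rewrite cat_rcons; apply: sub; rewrite /arcs /= inE ys orbT.
by exists w'.
Qed.

Lemma arcs_constant (P : pred (V I)) s :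
  (forall u v, (u, v) \in arcs s -> P u = P v) ->
  {in s &, forall u v, P u = P v}.
Proof.
case: s => [|a s] // Ps; suff Pa v : v \in a :: s -> P v = P a.
  by move=> u v /Pa-> /Pa->.
elim: s a Ps v => [|b s IHs] a Ps v; first by rewrite inE => /eqP->.
rewrite inE => /predU1P[->//|/IHs->]; first last.
  by move=> x y xy; apply: Ps; rewrite /arcs /= inE xy orbT.
by rewrite -(Ps a b) // /arcs /= inE eqxx.
Qed.

Lemma arcs_prev r v : v \in behead r -> exists u, (u, v) \in arcs r.
Proof.
case: r => [|a r] //= /path.splitPr[p1 p2].
case: (lastP p1) => [|p x]; first by exists a; apply/arcsP; exists [::], p2.
by exists x; apply/arcsP; exists (a :: p), p2; rewrite cat_rcons.
Qed.

Lemma arcs_next r v f : v \in r -> exists u, (v, u) \in arcs (rcons r f).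
Proof.
case/path.splitPr => p1 [|x p2].
  by exists f; apply/arcsP; exists p1, [::]; rewrite rcons_cat.
by exists x; apply/arcsP; exists p1, (rcons p2 f); rewrite rcons_cat.
Qed.
End Arcs.

Lemma sum_bool_gt0P (J : finType) (P b : pred J) :
  reflect (exists2 j, P j & b j) (0 < \sum_(j | P j) b j)%N.
Proof.
rewrite lt0n sum_nat_eq0 negb_forall; apply: (iffP existsP) => -[j].
  by rewrite negb_imply eqb0 negbK => /andP[]; exists j.
by move=> Pj bj; exists j; rewrite Pj bj.
Qed.

(** * Feasible routes and the uniqueness of their decomposition *)

Section Routes.
Variables (R : realType) (I : instance R).
Implicit Types (k : vehicle I) (r g : seq (V I)) (u v : V I) (x : solution I).
Implicit Types (f : frag I) (xi : {set frag I}) (bs : seq (seq (V I))).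

Lemma in_Nset v :
  (v \in Nset I) = match v with pick _ | drop _ => true | _ => false end.
Proof. by rewrite !inE; case: v. Qed.

Lemma route_uniq k r : is_route k r -> uniq r.
Proof. by case=> mid [f []]. Qed.

Lemma route_load0 k r (y : V I -> V I -> bool) L u : is_route k r ->
  load_ok k y L -> u \in r -> u \notin Nset I -> L u = 0 /\ load u = 0.
Proof.
move=> [mid [f [-> sub _]]] [_ _ L0]; rewrite inE mem_rcons inE.
case/or3P=> [/eqP->|/eqP->|/sub]; rewrite !inE.
- by rewrite L0 ?inE ?eqxx //; case: (load_orig (origin_of k)).
- by rewrite L0 ?inE ?eqxx ?orbT //; case: (load_dest f).
case: u => //= s _ _; rewrite L0 ?inE ?eqxx ?orbT //.
by case: (load_station s).
Qed.

(** The load at a pickup is at least its positive demand, while a successor outside [Nset] would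
    force it to be 0. *)
Lemma route_pick_next k r i : feasible_route k r -> pick i \in r ->
  exists2 j, j \in Nset I & (pick i, j) \in arcs r.
Proof.
move=> [rt [T [L [B [E [_ _ lo _]]]]]] ir.
have [j ij] : exists j, (pick i, j) \in arcs r.
  case: rt ir => mid [f [-> _ _]]; rewrite -rcons_cons mem_rcons inE /=.
  exact: arcs_next.
exists j => //; apply: contraT => jN.
have [Lj qj] := route_load0 rt lo (arcs_mem ij).2 jN.
case: lo => /(_ _ _ ij) + /(_ (pick i)) + _.
rewrite Lj qj addr0 in_Nset => <- /(_ isT)/andP[+ _].
by rewrite ge_max => /andP[_]; rewrite leNgt load_pick.
Qed.

(** Reached empty from a node outside [Nset], the drop-off would have a negative load. *)
Lemma route_drop_prev k r i : feasible_route k r -> drop i \in r ->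
  exists2 j, j \in Nset I & (j, drop i) \in arcs r.
Proof.
move=> [rt [T [L [B [E [_ _ lo _]]]]]] ir.
have [j ij] : exists j, (j, drop i) \in arcs r.
  by case: rt ir => mid [f [-> _ _]]; rewrite inE => ?;
    apply: (@arcs_prev _ _ (_ :: _)).
exists j => //; apply: contraT => jN.
have [Lj qj] := route_load0 rt lo (arcs_mem ij).1 jN.
case: lo => /(_ _ _ ij) + /(_ (drop i)) + _.
rewrite Lj add0r in_Nset => -> /(_ isT)/andP[+ _].
by rewrite ge_max load_drop => /andP[+ _]; rewrite oppr_ge0 leNgt load_pick.
Qed.

(** The pairing constraint counts only arcs within [Nset]; the two preceding lemmas place the
    relevant arcs there. *)
Lemma route_pick_drop k r i : feasible_route k r ->
  (pick i \in r) = (drop i \in r).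
Proof.
move=> fr; have /= ur := route_uniq fr.1.
have [_ [T [L [B [E [[_ _ _ /(_ i) fl] _ _ _]]]]]] := fr.
apply/idP/idP => [/(route_pick_next fr)|/(route_drop_prev fr)] [j jN ij].
  have : (0 < \sum_(j in Nset I | j != pick i) ((pick i, j) \in arcs r))%N.
    by apply/sum_bool_gt0P; exists j; rewrite // jN eq_sym (arcs_neq ur ij).
  by rewrite fl => /sum_bool_gt0P[j' _ /arcs_mem[_ ->]].
have : (0 < \sum_(j in Nset I | j != drop i) ((j, drop i) \in arcs r))%N.
  by apply/sum_bool_gt0P; exists j; rewrite // jN (arcs_neq ur ij).
by rewrite -fl => /sum_bool_gt0P[j' _ /arcs_mem[-> _]].
Qed.

Lemma feasible_route_of x k r : feasible x -> route_of x k r ->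
  feasible_route k r.
Proof.
move=> [_ [T [L [B [E [Rx [/(_ k) ok _ _ _]]]]]]] [rt xr]; split=> //.
exists (T k), (L k), (B k), (E k).
suff <- : (fun i j => x (k, i, j)) = (fun i j => (i, j) \in arcs r) by [].
by apply/funext => i; apply/funext => j; rewrite xr.
Qed.

Lemma route_of_inj x k r r' : route_of x k r -> route_of x k r' -> r = r'.
Proof.
move=> [[mid [f [-> _ u]]] xr] [[mid' [f' [-> _ u']]] xr'].
(* Following the arcs of one route along the other makes each a prefix of the other; comparing sizes
   leaves no remainder. *)
have [w e] : exists w, rcons mid (dest f) = rcons mid' (dest f') ++ w.
  by apply: (@arcs_follow _ _ [::] _ _ _ u) => -[i j]; rewrite -xr' xr.
have [w' e'] : exists w', rcons mid' (dest f') = rcons mid (dest f) ++ w'.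
  by apply: (@arcs_follow _ _ [::] _ _ _ u') => -[i j]; rewrite -xr xr'.
congr (_ :: _); rewrite e' e -catA; move/(congr1 size): e.
rewrite e' !size_cat -!addnA => /eqP.
rewrite -[X in X == _]addn0 eqn_add2l eq_sym addn_eq0 !size_eq0.
by case/andP=> /eqP-> /eqP->; rewrite cats0.
Qed.

Lemma pick_served x i : feasible x ->
  exists k r, route_of x k r /\ pick i \in r.
Proof.
move=> [rt [T [L [B [E [Rx [_ _ /(_ i) s1 _]]]]]]].
have : (0 < \sum_k \sum_(j in Nset I | j != pick i) x (k, pick i, j))%N.
  by rewrite s1.
rewrite lt0n sum_nat_eq0 negb_forall => /existsP[k].
rewrite -lt0n => /sum_bool_gt0P[j _ xj].
have [r xr] := rt k; exists k, r; split=> //.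
by move: xj; rewrite xr.2 => /arcs_mem[].
Qed.

(** Two vehicles visiting the pickup would give two positive terms in a sum equal to 1. *)
Lemma pick_route_inj x k k' r r' i : feasible x ->
  route_of x k r -> route_of x k' r' -> pick i \in r -> pick i \in r' -> k = k'.
Proof.
move=> fx xr xr' ir ir'; have [_ [T [L [B [E [Rx [_ _ /(_ i) s1 _]]]]]]] := fx.
have pos k1 r1 : route_of x k1 r1 -> pick i \in r1 ->
    (0 < \sum_(j in Nset I | j != pick i) x (k1, pick i, j))%N.
  move=> xr1 /(route_pick_next (feasible_route_of fx xr1))[j jN ij].
  apply/sum_bool_gt0P; exists j; last by rewrite xr1.2.
  by rewrite jN eq_sym (arcs_neq (route_uniq xr1.1) ij).
apply/eqP; apply: contraT => kk'; move: s1.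
rewrite (bigD1 k) //= (bigD1 k') 1?eq_sym //= addnA.
move: (pos _ _ xr ir) (pos _ _ xr' ir').
case: (\sum_(j in _ | _) x (k, _, _))%N => // a _.
by case: (\sum_(j in _ | _) x (k', _, _))%N => // b _; rewrite addSn addnS.
Qed.

Lemma node_route_inj x k k' r r' v : feasible x -> v \in Nset I ->
  route_of x k r -> route_of x k' r' -> v \in r -> v \in r' -> k = k'.
Proof.
move=> fx; rewrite in_Nset => + xr xr'; case: v => // i _.
  exact: (pick_route_inj fx xr xr').
rewrite -(route_pick_drop i (feasible_route_of fx xr)).
rewrite -(route_pick_drop i (feasible_route_of fx xr')).
exact: (pick_route_inj fx xr xr').
Qed.

Lemma node_served x v : feasible x -> v \in Nset I ->
  exists k r, route_of x k r /\ v \in r.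
Proof.
move=> fx; rewrite in_Nset; case: v => // i _;
  have [k [r [xr ir]]] := pick_served i fx.
  by exists k, r.
by exists k, r; split=> //;
  rewrite -(route_pick_drop i (feasible_route_of fx xr)).
Qed.

(** Stated through loads rather than [is_fragment], since the loads decide where a route is cut. *)
Definition block g := fragment_loads g \/ exists s, g = [:: station s].

(** A fragment is not a proper prefix of another: its final load is 0, whereas proper nonempty
    prefixes of a fragment carry passengers. *)
Lemma block_head_eq g g' w w' : block g -> block g' -> g ++ w = g' ++ w' ->
  (size g <= size g')%N -> g = g'.
Proof.
move=> bg bg' e le.
have eg : g = take (size g) g'.
  by have := congr1 (take (size g)) e; rewrite take_size_cat // takel_cat.
case: bg' => [[g'0 g'N pos tot]|[s g's]].
  case: bg => [[g0 gN _ tot']|[s gs]]; last first.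
    have : station s \in g'.
      by apply: (@mem_take (size g)); rewrite -eg gs mem_head.
    by move/g'N; rewrite in_Nset.
  move: le; rewrite leq_eqVlt => /predU1P[sz|lt].
    by rewrite eg sz take_size.
  have := pos (size g); rewrite lt lt0n size_eq0 g0 => /(_ isT).
  by move: tot'; rewrite /load_after -eg take_size => ->; rewrite ltxx.
case: bg => [[g0 _ _ _]|[s' gs']]; last by rewrite eg g's gs'.
by move: eg g0; rewrite g's; case: g e le => [|a [|]].
Qed.

Lemma blocks_inj bs bs' : {in bs, forall g, block g} ->
  {in bs', forall g, block g} -> flatten bs = flatten bs' -> bs = bs'.
Proof.
have nz g : block g -> g <> [::] by case=> [[/eqP//]|[s ->]].
elim: bs bs' => [|g bs IHbs] [|g' bs'] // bb bb'.
- move: (nz g' (bb' _ (mem_head _ _))) => /=; case: g' {bb'} => //.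
- move: (nz g (bb _ (mem_head _ _))) => /=; case: g {bb} => //.
move=> /= e.
have gg' : g = g'.
  have [|/ltnW] := leqP (size g) (size g').
    exact: block_head_eq (bb _ (mem_head _ _)) (bb' _ (mem_head _ _)) e.
  by move/(block_head_eq (bb' _ (mem_head _ _)) (bb _ (mem_head _ _)) (esym e)).
subst g'; congr (_ :: _); apply: IHbs.
- by move=> h hs; apply: bb; rewrite inE hs orbT.
- by move=> h hs; apply: bb'; rewrite inE hs orbT.
by have := congr1 (seq.drop (size g)) e; rewrite !drop_size_cat.
Qed.
End Routes.

(** * Fragments and families serving each request once *)

Section Fragments.
Variables (R : realType) (I : instance R).
Implicit Types (k : vehicle I) (r g : seq (V I)) (u v : V I) (x : solution I).
Implicit Types (f : frag I) (xi : {set frag I}) (bs : seq (seq (V I))).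

Lemma fragment_block g : is_fragment g -> block g.
Proof. by case; left. Qed.

Lemma fragment_Nset g v : is_fragment g -> v \in g -> v \in Nset I.
Proof. by case=> -[_ gN _ _] _ /gN. Qed.

Lemma fragment_mem g : is_fragment g -> exists v, v \in g.
Proof. by case; case; case: g => // v g *; exists v; apply: mem_head. Qed.

Lemma fragment_uniq g : is_fragment g -> uniq g.
Proof.
case=> _ [k [s1 [s2 [d [/route_uniq]]]]] /=.
by rewrite !cat_uniq => /and4P[_ _ _ /and3P[]].
Qed.

Lemma fragment_pick_drop g i : is_fragment g -> (pick i \in g) = (drop i \in g).
Proof.
case=> _ [k [s1 [s2 [d fr]]]]; have := route_pick_drop i fr.
have nst v s : v \in Nset I -> (v \in map station s) = false.
  by move=> vN; apply/negP => /mapP[s' _ e]; rewrite e in_Nset in vN.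
by rewrite !(inE, mem_cat) !nst ?in_Nset //= !orbF.
Qed.

Lemma in_fragments f : (f \in fragments I) = `[< is_fragment f >].
Proof. by rewrite inE. Qed.

(** Combinatorial form of the equality constraints of the selection step, as shown by
    [coveringP]. *)
Definition covering xi :=
  xi \subset fragments I /\
  forall i, exists f, [set f' in xi | in_frag i f'] = [set f].

Lemma coveringP xi : covering xi <-> xi \subset fragments I /\
  forall i, (\sum_(f in fragments I) in_frag i f * (f \in xi) = 1)%N.
Proof.
have sumE i : xi \subset fragments I ->
    (\sum_(f in fragments I) in_frag i f * (f \in xi) =
     #|[set f in xi | in_frag i f]|)%N.
  move=> /fintype.subsetP sub; rewrite -sum1_card [LHS](bigID (mem xi)) /=.
  rewrite [X in (_ + X)%N]big1 ?addn0.
    rewrite [LHS](bigID (in_frag i)) /= [X in (_ + X)%N]big1 ?addn0.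
      apply: eq_big => [f|f /andP[/andP[_ ->] ->//]].
      have := sub f; rewrite !inE; case: (f \in xi) => [/(_ isT)/asboolT->//|_].
      by rewrite andbF.
    by move=> f /andP[_ /negbTE->].
  by move=> f /andP[_ /negbTE->]; rewrite muln0.
split=> -[sub cov]; split=> // i.
  by have [f e] := cov i; rewrite sumE // e cards1.
by apply/cards1P; rewrite -sumE // cov.
Qed.

Lemma covering_fragment xi f : covering xi -> f \in xi -> is_fragment f.
Proof.
by move=> [/fintype.subsetP sub _] /sub; rewrite in_fragments => /asboolP.
Qed.

Lemma covering_pick xi i : covering xi ->
  exists2 f, f \in xi & pick i \in (f : seq _).
Proof.
move=> [_ /(_ i)[f e]]; have := set11 f; rewrite -e inE => /andP[? ?].
by exists f.
Qed.

Lemma covering_pick_inj xi i f f' : covering xi -> f \in xi -> f' \in xi ->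
  pick i \in (f : seq _) -> pick i \in (f' : seq _) -> f = f'.
Proof.
move=> [_ /(_ i)[h e]] fxi f'xi fi f'i.
have: f \in [set h] by rewrite -e inE fxi.
have: f' \in [set h] by rewrite -e inE f'xi.
by rewrite !inE => /eqP-> /eqP->.
Qed.

Lemma covering_mem xi v : covering xi -> v \in Nset I ->
  exists2 f, f \in xi & v \in (f : seq _).
Proof.
move=> cov; rewrite in_Nset; case: v => // i _;
  have [f fxi fi] := covering_pick i cov; exists f => //.
by rewrite -fragment_pick_drop //; apply: covering_fragment fxi.
Qed.

Lemma covering_inj xi v f f' : covering xi -> f \in xi -> f' \in xi ->
  v \in (f : seq _) -> v \in (f' : seq _) -> f = f'.
Proof.
move=> cov fxi f'xi vf; have := fragment_Nset (covering_fragment cov fxi) vf.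
rewrite in_Nset; case: v vf => // i + _.
  exact: covering_pick_inj fxi f'xi.
rewrite -(fragment_pick_drop i (covering_fragment cov fxi)).
rewrite -(fragment_pick_drop i (covering_fragment cov f'xi)).
exact: covering_pick_inj fxi f'xi.
Qed.

(** Each arc of [g] is used by some vehicle, and a node of [Nset] lies on the route of one vehicle
    only; so membership in [r] propagates along [g]. *)
Lemma fragment_in_route x k r g v : feasible x -> is_fragment g ->
  (forall i j, (i, j) \in arcs g -> exists k, x (k, i, j)) ->
  route_of x k r -> v \in g -> v \in r ->
  {subset arcs g <= arcs r} /\ {subset g <= r}.
Proof.
move=> fx gf xg xr vg vr.
have same a b : (a, b) \in arcs g -> (a \in r) || (b \in r) ->
    (a, b) \in arcs r.
  move=> ab; have [k' xab] := xg _ _ ab; have [r' xr'] := fx.1 k'.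
  have ab' : (a, b) \in arcs r' by rewrite -xr'.2.
  have [aN bN] : a \in Nset I /\ b \in Nset I.
    by split; apply: (fragment_Nset gf); rewrite (arcs_mem ab).
  have [ar' br'] := arcs_mem ab'.
  move=> abr; suff ek : k' = k by subst k'; rewrite (route_of_inj xr xr').
  by case/orP: abr => [ar|br];
    [exact: node_route_inj xr' xr ar' ar | exact: node_route_inj xr' xr br' br].
have cst : {in g &, forall a b, (a \in r) = (b \in r)}.
  apply: arcs_constant => a b ab; have := same _ _ ab.
  case: (boolP (a \in r)) => [_ /(_ isT)/arcs_mem[_ ->//]|/negbTE anr h].
  by apply/esym/negbTE/negP => /h/arcs_mem[]; rewrite anr.
have sub : {subset g <= r} by move=> a ag; rewrite (cst a v).
split=> // -[a b] ab; apply: same => //.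
by rewrite sub // (arcs_mem ab).
Qed.

(* The fragment of xi through the first node v of a suffix of the route       *)
(* starts at v: a node before v in it would also precede v on the route.      *)
Lemma covering_concatenation x k r xi : feasible x -> covering xi ->
  (forall f i j, f \in xi -> (i, j) \in arcs f -> exists k, x (k, i, j)) ->
  route_of x k r ->
  exists bs, concatenation k r bs /\
    forall g, g \in bs ->
      (exists2 f, f \in xi & g = f) \/ exists s, g = [:: station s].
Proof.
move=> fx cov xf xr; have [[mid [d [er midN ur]]] _] := xr.
have xiN f : f \in xi -> {subset (f : seq _) <= Nset I}.
  by move=> fxi v; apply: fragment_Nset (covering_fragment cov fxi).
(* Induction on a suffix [w] of the route, with the invariant that a fragment of [xi] meeting [w]
   lies inside [w]. *)
suff dec n pre w : (size w <= n)%N -> mid = pre ++ w ->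
    (forall f v, f \in xi -> v \in (f : seq _) -> v \in w ->
      {subset (f : seq _) <= w}) ->
    exists2 bs, flatten bs = w & forall g, g \in bs ->
      (exists2 f, f \in xi & g = f) \/ exists s, g = [:: station s].
  have [|bs ebs bsP] := dec (size mid) [::] mid (leqnn _) erefl.
    move=> f v fxi vf vm u uf.
    have vr : v \in r by rewrite er inE mem_rcons inE vm !orbT.
    have [_ sub] := fragment_in_route fx (covering_fragment cov fxi)
      (fun i j => xf f i j fxi) xr vf vr.
    have := xiN _ fxi _ uf; have := sub _ uf.
    by rewrite er inE mem_rcons inE => /or3P[/eqP->|/eqP->|//]; rewrite in_Nset.
  exists bs; split=> //; split; first by exists d; rewrite ebs.
  by move=> g /bsP[[f fxi ->]|]; [left; apply: covering_fragment fxi | right].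
elim: n pre w => [|n IHn] pre w szw em clw.
  by exists [::] => //; case: w szw {em clw}.
case: w szw em clw => [|v w] szw em clw; first by exists [::].
have vm : v \in mid by rewrite em mem_cat mem_head orbT.
have vr : v \in r by rewrite er inE mem_rcons inE vm !orbT.
have erv : r = (start k :: pre) ++ v :: rcons w (dest d).
  by rewrite er em rcons_cat.
have uv : uniq ((start k :: pre) ++ v :: rcons w (dest d)) by rewrite -erv.
have [vN|vnN] := boolP (v \in Nset I); last first.
  have [s ev] : exists s, v = station s.
    by move: (midN _ vm) vnN; rewrite !inE; case: (v) => // s _ _; exists s.
  have [|||bs ebs bsP] := IHn (rcons pre v) w.
  - by [].
  - by rewrite cat_rcons.
  - move=> f u fxi uf uw a af.
    have := clw f u fxi uf; rewrite inE uw orbT => /(_ isT a af).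
    by rewrite inE => /predU1P[e|//]; rewrite -e (xiN f) in vnN.
  exists ([:: v] :: bs) => [|g]; first by rewrite /= ebs.
  by rewrite inE => /predU1P[->|/bsP//]; right; exists s; rewrite ev.
have [f fxi vf] := covering_mem cov vN.
have ff := covering_fragment cov fxi.
have uf := fragment_uniq ff.
have [subf _] := fragment_in_route fx ff (fun i j => xf f i j fxi) xr vf vr.
have [c ef] : exists c, f = v :: c :> seq _.
  have [a [c ef]] : exists a c, f = a ++ v :: c :> seq _.
    by case/path.splitPr: (vf) => a c; exists a, c.
  case/lastP: a ef => [|a u] ef; first by exists c.
  have /subf/arcsP[l1 [l2]] : (u, v) \in arcs f.
    by apply/arcsP; exists a, c; rewrite ef cat_rcons.
  rewrite erv -(cat_rcons u l1) => /(uniq_split_inj uv)[eu _].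
  have uin : u \in start k :: pre by rewrite eu mem_rcons mem_head.
  have : u \in v :: w.
    apply: clw vf (mem_head _ _) _ _ => //.
    by rewrite ef mem_cat mem_rcons mem_head.
  move: uv; rewrite cat_uniq => /and3P[_ /hasPn nin _] uw.
  have := nin u; rewrite uin => /(_ _)/negP[] //.
  by rewrite -rcons_cons mem_rcons inE uw orbT.
have [w' ew'] : exists w', rcons w (dest d) = c ++ w'.
  by apply: arcs_follow uv _; rewrite -ef -erv.
(* The fragment stops before the destination depot, which is outside [Nset]. *)
have [w2 ew] : exists w2, w = c ++ w2.
  case/lastP: w' ew' => [|w2 y] ew'.
    have : dest d \in (f : seq _).
      by rewrite ef inE -[c]cats0 -ew' mem_rcons mem_head orbT.
    by move/(xiN f fxi); rewrite in_Nset.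
  by exists w2; move: ew'; rewrite -rcons_cat => /rcons_inj[].
have evw : v :: w = f ++ w2 by rewrite ef ew.
have [|||bs ebs bsP] := IHn (pre ++ f) w2.
- move: szw; rewrite evw size_cat ef => h.
  by rewrite -ltnS; apply: leq_trans h; rewrite ltnS leq_addl.
- by rewrite -catA -evw.
(* A fragment meeting both [f] and [w2] would be [f] itself, but [f ++ w2] repeats no node. *)
- move=> f' u f'xi uf' uw2 a af'.
  have := clw f' u f'xi uf'; rewrite evw mem_cat uw2 orbT => /(_ isT a af').
  rewrite mem_cat => /orP[af|//].
  have ? := covering_inj cov fxi f'xi af af'; subst f'.
  have : uniq (f ++ w2).
    move: uv; rewrite cat_uniq -rcons_cons rcons_uniq evw => /and3P[_ _].
    by case/andP.
  by rewrite cat_uniq => /and3P[_ /hasPn/(_ _ uw2)/negP[]].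
exists ((f : seq _) :: bs) => [|g]; first by rewrite /= ebs -evw.
by rewrite inE => /predU1P[->|/bsP//]; left; exists f.
Qed.
End Fragments.

(** * Composition of a solution, and the cuts *)

Lemma finite_minimizer (R : realType) (T : finType) (A : T -> Prop)
    (g : T -> R) :
  (exists x, A x) -> exists x, A x /\ forall x', A x' -> g x <= g x'.
Proof.
case=> x0 /asboolP Ax0.
case: (@Order.TotalTheory.arg_minP _ _ _ x0 (fun x => `[< A x >]) g Ax0).
move=> x /asboolP Ax xmin.
by exists x; split=> // x' /asboolP/xmin.
Qed.

Lemma flatten_uniq_inj (T : eqType) (bs : seq (seq T)) g g' v :
  uniq (flatten bs) -> g \in bs -> g' \in bs -> v \in g -> v \in g' -> g = g'.
Proof.
elim: bs => //= h bs IHbs; rewrite cat_uniq => /and3P[_ /hasPn nh ubs].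
have out g1 : g1 \in bs -> v \in g1 -> v \notin h.
  by move=> g1b vg1; apply: nh; apply/flattenP; exists g1.
rewrite !inE => /predU1P[->|gb] /predU1P[->|g'b] // vg vg'.
- by have := out _ g'b vg'; rewrite vg.
- by have := out _ gb vg; rewrite vg'.
exact: IHbs.
Qed.

Section Composition.
Variables (R : realType) (I : instance R).
Implicit Types (k : vehicle I) (r g : seq (V I)) (u v : V I) (x : solution I).
Implicit Types (f : frag I) (xi : {set frag I}) (bs : seq (seq (V I))).

Lemma concatenation_inj k r bs bs' : concatenation k r bs ->
  concatenation k r bs' -> bs = bs'.
Proof.
have blk cs :
    (forall g, g \in cs -> is_fragment g \/ exists s, g = [:: station s]) ->
    {in cs, forall g, block g}.
  by move=> csP g /csP[/fragment_block|]; [|right].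
move=> [[d ->] /blk bsP] [[d' [e]] /blk bsP'].
by apply: blocks_inj => //; case: (rcons_inj e).
Qed.

(** [covering_concatenation] cuts every route into members of [xi] and stations, and this cutting is
    the only one; conversely, a node of a member of [xi] is served inside a block that must be that
    member. *)
Lemma check_feasible_composes x xi : covering xi -> check_feasible xi x ->
  forall f, composes f x <-> f \in xi.
Proof.
move=> cov [fx xf] f; split.
  case=> ff [k [r [bs [xr cat fbs]]]].
  have [bs' [cat' bsP]] := covering_concatenation fx cov xf xr.
  move: fbs; rewrite (concatenation_inj cat cat').
  case/bsP=> [[f' f'xi /val_inj->]|[s fs]] //.
  have := fragment_Nset ff (v := station s).
  by rewrite fs mem_head in_Nset => /(_ isT).
move=> fxi; have ff := covering_fragment cov fxi; split=> //.
have [v vf] := fragment_mem ff.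
have vN := fragment_Nset ff vf.
have [k [r [xr vr]]] := node_served fx vN.
have [bs [cat bsP]] := covering_concatenation fx cov xf xr.
exists k, r, bs; split=> //.
have : v \in flatten bs.
  case: cat vr => -[d ->] _; rewrite inE mem_rcons inE.
  by case/or3P=> [/eqP e|/eqP e|//]; rewrite e in_Nset in vN.
case/flattenP => g gbs vg; case: (bsP _ gbs) => [[f' f'xi e]|[s e]].
  by rewrite (covering_inj cov fxi f'xi vf) -?e.
by move: vg; rewrite e inE => /eqP ev; rewrite ev in_Nset in vN.
Qed.

Definition composition x : {set frag I} := [set f | `[< composes f x >]].

Lemma compositionP x f : reflect (composes f x) (f \in composition x).
Proof. by rewrite finset.in_set; apply: asboolP. Qed.

(** A pickup lies on one route and in one block of its unique decomposition; this block is not a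
    station, hence a fragment. *)
Lemma composition_covering x : routes_are_concatenations I -> feasible x ->
  covering (composition x).
Proof.
move=> fact fx; split.
  apply/fintype.subsetP => f /compositionP[ff _].
  by rewrite in_fragments; apply/asboolP.
move=> i; have [k [r [xr ir]]] := pick_served i fx.
have [bs cat] := fact k r (feasible_route_of fx xr).
have ubs : uniq (flatten bs).
  have := route_uniq xr.1; case: cat => -[d ->] _ /=; rewrite rcons_uniq.
  by case/and3P.
have [g gbs ig] : exists2 g, g \in bs & pick i \in g.
  apply/flattenP; case: cat ir => -[d ->] _; rewrite inE mem_rcons inE.
  by case/or3P=> // /eqP.
have fg : is_fragment g.
  by case: (cat.2 _ gbs) ig => // -[s ->]; rewrite inE => /eqP.
have sg : (size g <= #|{: V I}|)%N.
  by rewrite -(card_uniqP (fragment_uniq fg)) max_card.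
exists (Bseq sg); apply/setP => f.
rewrite finset.in_set finset.in_set1 /in_frag.
apply/andP/eqP => [[/compositionP[ff [k' [r' [bs' [xr' cat' fbs']]]]] fi]|->].
  have ir' : pick i \in r'.
    case: cat' => -[d ->] _; rewrite inE mem_rcons inE; apply/or3P; apply: Or33.
    by apply/flattenP; exists (f : seq _).
  have ek := pick_route_inj fx xr xr' ir ir'; subst k'.
  have er := route_of_inj xr xr'; subst r'.
  have eb := concatenation_inj cat cat'; subst bs'.
  by apply: val_inj; apply: flatten_uniq_inj ubs fbs' gbs fi ig.
split=> //; apply/compositionP; split=> //.
by exists k, r, bs.
Qed.

Lemma composition_check x : feasible x -> check_feasible (composition x) x.
Proof.
move=> fx; split=> // f i j.
case/compositionP=> _ [k [r [bs [xr [[d er] _] fbs]]]] ij.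
have [b1 [b2 eb]] : exists b1 b2, bs = b1 ++ (f : seq (V I)) :: b2.
  by case/path.splitPr: fbs => b1 b2; exists b1, b2.
exists k; rewrite xr.2.
apply: (@arcs_infix _ _ f _ (start k :: flatten b1)
  (rcons (flatten b2) (dest d))) ij.
by rewrite er eb flatten_cat /= -!rcons_cat.
Qed.

Lemma sum_fragments_mem xi (F : frag I -> R) : xi \subset fragments I ->
  \sum_(f in fragments I) F f * (f \in xi)%:R = \sum_(f in xi) F f.
Proof.
move=> /fintype.subsetP sub; rewrite [LHS](bigID (mem xi)) /=.
rewrite [X in _ + X]big1 ?addr0.
  apply: eq_big => [f|f /andP[_ ->]]; last by rewrite mulr1.
  by case: (boolP (f \in xi)) => [/sub->//|_]; rewrite andbF.
by move=> f /andP[_ /negbTE->]; rewrite mulr0.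
Qed.

Lemma z2_composition x : excess_is_additive I -> feasible x ->
  z2 x = \sum_(f in composition x) frag_excess f.
Proof.
move=> fact /fact ->; apply: eq_bigl => f.
by apply/asboolP/idP => /compositionP.
Qed.

Lemma cut_notsubset (xi xi' : {set frag I}) :
  (\sum_(f in xi') (f \in xi)%:R <= #|xi'|%:R - 1 :> R) = ~~ (xi' \subset xi).
Proof.
have -> : \sum_(f in xi') (f \in xi)%:R = #|xi' :&: xi|%:R :> R.
  rewrite -sum1_card natr_sum [LHS](bigID (mem xi)) /= [X in _ + X]big1 ?addr0.
    by apply: eq_big => [f|f /andP[_ ->]//]; rewrite finset.in_setI.
  by move=> f /andP[_ /negbTE->].
rewrite lerBrDr natr1 ler_nat ltn_neqAle.
rewrite subset_leq_card ?finset.subsetIl // andbT.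
rewrite (subset_leqif_cards (finset.subsetIl _ _)).
by congr negb; apply/eqP/finset.setIidPl.
Qed.

(** Any member of [xi] shares a node with a member of [xi'], which is also in [xi] and therefore
    equal to it. *)
Lemma covering_subset_eq xi xi' : covering xi -> covering xi' ->
  xi' \subset xi -> xi' = xi.
Proof.
move=> cov cov' sub; apply/eqP; rewrite finset.eqEsubset sub /=.
apply/fintype.subsetP => f fxi; have ff := covering_fragment cov fxi.
have [v vf] := fragment_mem ff.
have [f' f'xi vf'] := covering_mem cov' (fragment_Nset ff vf).
by rewrite (covering_inj cov fxi (fintype.subsetP sub _ f'xi) vf vf').
Qed.

(** The inequalities tested by Select-and-Check: the first in [check_success], the other two in
    [select_feasible]. *)
Definition in_region (rg : region R) (p : point R) : bool :=
  (p.1 < rg.2.1) && (rg.2.2 <= p.2 < rg.1.2).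

Lemma select_feasible_covering (rg : region R) Xi xi :
  select_feasible rg Xi xi -> covering xi.
Proof. by case=> sub cov _ _; apply/coveringP. Qed.

Lemma select_feasible_notin (rg : region R) Xi xi :
  select_feasible rg Xi xi -> xi \notin Xi.
Proof.
by case=> _ _ _ cut; apply/negP => /cut; rewrite cut_notsubset fintype.subxx.
Qed.

Lemma check_success_region (rg : region R) Xi xi x : excess_is_additive I ->
  select_feasible rg Xi xi -> check_success rg xi x ->
  feasible x /\ in_region rg (z x).
Proof.
move=> fact sel [[cx _] z1x]; have [fx _] := cx; split=> //.
rewrite /in_region z1x /= z2_composition //.
have -> : composition x = xi.
  apply/setP => f; apply/compositionP/idP => h;
  by apply/(check_feasible_composes (select_feasible_covering sel) cx).
by case: sel => sub _ + _; rewrite sum_fragments_mem.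
Qed.

Definition rejected (rg : region R) (Xi : {set {set frag I}}) : Prop :=
  forall xi, xi \in Xi -> covering xi /\ ~ exists x, check_success rg xi x.

(** A cut excluding the composition of [x] would come from that very family; but [x] passes its
    check, so it cannot have been rejected. *)
Lemma composition_select_feasible (rg : region R) Xi x :
  routes_are_concatenations I -> excess_is_additive I -> rejected rg Xi ->
  feasible x -> in_region rg (z x) -> select_feasible rg Xi (composition x).
Proof.
move=> rfact efact rej fx /andP[z1x z2x].
have cov := composition_covering rfact fx.
have [sub sum1] := (coveringP _).1 cov; split=> //.
  by rewrite sum_fragments_mem // -z2_composition.
move=> xi' /rej[cov' nosucc]; rewrite cut_notsubset; apply/negP => xi'sub.
apply: nosucc; rewrite (covering_subset_eq cov cov' xi'sub).
have cx := composition_check fx.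
have [x' x'min] := finite_minimizer (@z1 _ I)
  (ex_intro (check_feasible (composition x)) x cx).
by exists x'; split=> //; apply: le_lt_trans z1x; apply: x'min.2.
Qed.
End Composition.

(** * Termination and completeness of Select-and-Check *)

Section Algorithm.
Variables (R : realType) (I : instance R).
Hypotheses (route_fact : routes_are_concatenations I)
  (excess_fact : excess_is_additive I).
Implicit Types (x : solution I) (zT znew : point R) (rg : region R)
  (rec : seq (region R)) (cand : {set solution I}).

Section SelectAndCheck.
Variables (G : config I -> Prop) (zT : point R) (rec : seq (region R))
  (cand : {set solution I}) (rg : region R).
Hypotheses
  (loop_none : (forall x, feasible x -> ~~ in_region rg (z x)) ->
     guaranteed G (Loop zT rec cand))
  (loop_found : forall x, feasible x -> in_region rg (z x) ->
     guaranteed G (Loop zT (update zT rg (z x) rec) (x |: cand)%SET)).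

(** Each rejected family is new, because its own cut would exclude it, so the complement of [Xi]
    shrinks. The section hypotheses are the two continuations in the main loop. *)
Lemma guaranteed_select Xi : rejected rg Xi ->
  guaranteed G (Select zT rec cand rg Xi).
Proof.
have [n] := ubnP #|~: Xi|; elim: n Xi => // n IHn Xi ltn rej.
apply: guaranteed_later.
  have [ex|nex] := pselect (exists xi, select_feasible rg Xi xi).
    have [xi opt] := finite_minimizer (@frags_time _ I) ex.
    by eexists; apply: step_select opt.
  by eexists; apply: step_none nex.
move=> c' st; inversion st as [| | |? ? ? ? ? xi opt|? ? ? ? ? nex| |]; subst.
  have [sel _] := opt; apply: guaranteed_later.
    have [[x suc]|nsuc] := pselect (exists x, check_success rg xi x).
      by eexists; apply: step_found suc.
    by eexists; apply: step_reject nsuc.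
  move=> c'' st'.
  inversion st' as [| | | | |? ? ? ? ? ? x suc|? ? ? ? ? ? nsuc]; subst.
    by have [] := check_success_region excess_fact sel suc; apply: loop_found.
  apply: IHn => [|xi'].
    rewrite -ltnS; apply: leq_trans ltn; rewrite ltnS; apply: proper_card.
    rewrite finset.properEneq finset.setCS finset.subsetUr andbT.
    apply: contraNneq (select_feasible_notin sel).
    move/(congr1 (fun A : {set {set frag I}} => xi \in A)).
    by rewrite !finset.in_setC finset.setU11 /= => /esym/negbFE.
  rewrite finset.in_setU1 => /predU1P[->|/rej//].
  by split=> //; apply: select_feasible_covering sel.
apply: loop_none => x fx; apply/negP => xrg; apply: nex; exists (composition x).
exact: composition_select_feasible.
Qed.
End SelectAndCheck.

(** * Splitting a region: the updated list and its weight *)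

Lemma dominatesPn (u v : point R) : ~~ dominates u v -> u <> v ->
  v.1 < u.1 \/ v.2 < u.2.
Proof.
case: u v => [u1 u2] [v1 v2].
rewrite /dominates /= !negb_and !negb_or -!ltNge -!leNgt.
case/or3P=> [?|?|/andP[le1 le2]] ne; [by left|by right|].
move: le1 le2 ne; rewrite !le_eqVlt => /predU1P[->|?]; last by left.
by case/predU1P=> [->|?]; [|right].
Qed.

(** Under the list invariant the scan stops at the first region it meets, whose top is [zT]; [base]
    omits this region when it is trimmed to [(zT, znew)]. *)
Lemma updateP zT rg znew rec : ~~ dominates znew zT ->
  all (fun rg => rg.1 == zT) rec -> (rec = [::] -> rg.1 = zT) ->
  exists base, update zT rg znew rec = base ++ [:: (zT, znew); (znew, rg.2)] /\
    (base = rec \/ exists bb, rec = rcons base (zT, bb) /\ dominates znew bb).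
Proof.
move=> ndom tops; rewrite /update.
have [//|rgT recN] := eqVneq rg.1 zT; first by exists rec; split=> //; left.
case/lastP: rec tops recN => [_ /(_ erefl)/eqP|rec [bt bb]].
  by rewrite (negbTE rgT).
rewrite all_rcons => /andP[/= /eqP-> _] _.
rewrite rev_rcons /= (negbTE ndom); case: ifP => [dom|_].
  exists rec; split; last by right; exists bb.
  by rewrite !rev_cons revK -!cats1 -!catA.
exists (rcons rec (zT, bb)); split; last by left.
by rewrite !rev_cons revK -!cats1 -!catA.
Qed.

(* Lexicographic: the left part R(zT, znew) of a split region has a smaller   *)
(* right end, and R(znew, zb) keeps the right end but has a smaller top.      *)
Definition region_rank rg : nat :=
  #|[set x : solution I | z1 x < rg.2.1]| * #|solution I|.+1
  + #|[set x : solution I | z2 x < rg.1.2]|.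

(** With base 3, a region outweighs any two regions of smaller rank. *)
Definition regions_weight rec : nat := \sum_(rg <- rec) 3 ^ region_rank rg.

Lemma region_rank_split zT rg x : in_region rg (z x) ->
  (region_rank (zT, z x) < region_rank rg)%N /\
  (region_rank (z x, rg.2) < region_rank rg)%N.
Proof.
case/and3P=> x1 _ x2; rewrite /region_rank /=.
(* Strictness comes from [x] itself, counted for the old bound but not for the new one. *)
have card_lt (g : solution I -> R) a b y : g y < b -> a <= g y ->
    (#|[set x | (g x < a)%R]| < #|[set x | (g x < b)%R]|)%N.
  move=> gb ga; apply: proper_card; apply/fintype.properP; split.
    apply/fintype.subsetP => w; rewrite !inE => ha.
    exact: lt_trans (lt_le_trans ha ga) gb.
  by exists y; rewrite !inE // -leNgt.
split; last by rewrite ltn_add2l; apply: (card_lt _ _ _ x).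
have lt1 := card_lt (@z1 _ I) (z1 x) _ x x1 (lexx _).
(* A drop of the first count outweighs the second count, which is at most [#|solution I|]. *)
apply: leq_trans (leq_addr _ _); apply: leq_trans (leq_mul lt1 (leqnn _)).
by rewrite mulSn addnC ltn_add2r ltnS max_card.
Qed.

Lemma regions_weight_update zT rg rec x : ~~ dominates (z x) zT ->
  all (fun rg => rg.1 == zT) rec -> (rec = [::] -> rg.1 = zT) ->
  in_region rg (z x) ->
  (regions_weight (update zT rg (z x) rec) < regions_weight (rcons rec rg))%N.
Proof.
move=> ndom tops recN xrg.
have [base [-> baseP]] := updateP ndom tops recN.
have [r1 r2] := region_rank_split zT xrg.
rewrite /regions_weight big_cat -cats1 big_cat /= !big_cons !big_nil !addn0.
apply: leq_ltn_trans (_ : (\sum_(rg0 <- rec) 3 ^ region_rank rg0 +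
   (3 ^ region_rank (zT, z x) + 3 ^ region_rank (z x, rg.2)) < _)%N).
  rewrite leq_add2r; case: baseP => [->//|[bb [-> _]]].
  by rewrite -cats1 big_cat leq_addr.
rewrite ltn_add2l; case: (region_rank rg) r1 r2 => // m; rewrite !ltnS => r1 r2.
apply: leq_ltn_trans (leq_add (leq_pexp2l _ r1) (leq_pexp2l _ r2)) _ => //.
by rewrite addnn -mul2n expnS ltn_pmul2r // expn_gt0.
Qed.

Definition covers_frontier rec cand : Prop :=
  forall x, efficient x -> (exists2 x', x' \in cand & z x' = z x) \/
    exists2 rg, rg \in rec & in_region rg (z x).

(** * Invariants of the main loop *)

Section MainLoop.
Variables (zT : point R).
Hypotheses (zT_undominated : forall x, feasible x -> ~~ dominates (z x) zT)
  (zT_top : forall x, efficient x -> z x = zT \/ (z x).2 < zT.2).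

(** An efficient image not dominated by [z x] and distinct from it lies in [(zT, z x)] if its second
    coordinate is at least that of [z x]; otherwise it remains in the lower part of the split
    region. *)
Lemma covers_frontier_update rec rg cand x :
  (exists2 xT, xT \in cand & z xT = zT) ->
  all (fun rg => rg.1 == zT) rec -> (rec = [::] -> rg.1 = zT) ->
  feasible x -> in_region rg (z x) -> covers_frontier (rcons rec rg) cand ->
  covers_frontier (update zT rg (z x) rec) (x |: cand)%SET.
Proof.
move=> [xT xTc exT] tops recN fx xrg cov y effy.
have [e|ney] := pselect (z x = z y).
  by left; exists x; rewrite ?finset.setU11.
have [yT|lty] := zT_top effy.
  by left; exists xT; rewrite ?exT ?yT //; apply: finset.setU1r.
case: (cov y effy) => [[x' x'c e]|[rg' rg'in yrg']].
  by left; exists x'; rewrite // finset.setU1r.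
right; have [base [-> baseP]] := updateP (zT_undominated fx) tops recN.
have ndom : ~~ dominates (z x) (z y).
  by apply/negP => dom; apply: effy.2; exists x.
have cmp := dominatesPn ndom ney.
have split_zT : (z x).2 <= (z y).2 -> in_region (zT, z x) (z y).
  move=> le; rewrite /in_region /= le lty !andbT.
  by case: cmp => //; rewrite ltNge le.
have in_zT : (z x).2 <= (z y).2 -> exists2 rg0,
    rg0 \in base ++ [:: (zT, z x); (z x, rg.2)] & in_region rg0 (z y).
  by move=> le; exists (zT, z x); rewrite ?split_zT // mem_cat !inE eqxx orbT.
move: rg'in; rewrite mem_rcons inE => /predU1P[e|rg'rec].
  subst rg'; have [/in_zT//|lt] := leP (z x).2 (z y).2.
  exists (z x, rg.2); first by rewrite mem_cat !inE eqxx !orbT.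
  by case/and3P: yrg' => y1 y2 _; rewrite /in_region /= y1 y2 lt.
case: baseP => [eb|[bb [er dom]]].
  by exists rg'; rewrite // mem_cat eb rg'rec.
(* The region [(zT, bb)] was trimmed: as [z x] dominates [bb], its efficient images have second
   coordinate at least that of [z x] and fall in [(zT, z x)]. *)
move: rg'rec; rewrite er mem_rcons inE => /predU1P[e|rg'b].
  apply: in_zT; case/and3P: dom => _ le _; apply: le_trans le _.
  by case/and3P: yrg'; rewrite e.
by exists rg'; rewrite // mem_cat rg'b.
Qed.

(** Induction on [regions_weight]. The condition on tops singles out the last region, the only one
    whose top may differ from [zT]. *)
Lemma guaranteed_loop rec cand :
  (forall x, x \in cand -> feasible x) ->
  (exists2 xT, xT \in cand & z xT = zT) ->
  (forall rec' rg, rec = rcons rec' rg ->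
     all (fun rg => rg.1 == zT) rec' /\ (rec' = [::] -> rg.1 = zT)) ->
  covers_frontier rec cand ->
  guaranteed (@returns_all_nondominated R I) (Loop zT rec cand).
Proof.
have [n] := ubnP (regions_weight rec).
elim: n rec cand => // n IHn rec cand ltn.
move=> fc xTc tops cov; apply: guaranteed_later.
  by case/lastP: rec {ltn tops cov} => [|rec rg]; eexists; constructor.
move=> c' st; inversion st as [|? rec' rg ? e|? ? e| | | |]; subst; last first.
  (* No region is left, so each efficient image belongs to a candidate; the final filter keeps it,
     all candidates being feasible. *)
  apply: guaranteed_now; exists (nondominated_part cand) => // _ [y effy <-].
  case: (cov y effy) => [[x xc e]|[]//]; exists x => //.
  rewrite finset.in_set xc /=; apply/negP => /existsP[x' /andP[x'c dom]].
  by apply: effy.2; exists x'; [exact: fc|rewrite -e].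
have [tops' recN] := tops _ _ erefl.
have weight_rcons : (regions_weight rec' < regions_weight (rcons rec' rg))%N.
  by rewrite /regions_weight -cats1 big_cat /= big_seq1 -[X in (X < _)%N]addn0
    ltn_add2l expn_gt0.
apply: guaranteed_select => [none|x fx xrg|xi]; last by rewrite finset.in_set0.
  apply: IHn => //.
  - by rewrite -ltnS; apply: leq_trans ltn; rewrite ltnS.
  - move=> rec0 rg0 e0; move: tops'.
    by rewrite e0 all_rcons => /andP[/eqP-> ->].
  move=> y effy; case: (cov y effy) => [?|[rg' + yrg']]; first by left.
  rewrite mem_rcons inE => /predU1P[e|]; last by right; exists rg'.
  by have := none y effy.1; rewrite -e yrg'.
apply: IHn.
- rewrite -ltnS; apply: leq_trans ltn; rewrite ltnS.
  exact: regions_weight_update (zT_undominated fx) tops' recN xrg.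
- by move=> y; rewrite finset.in_setU1 => /predU1P[->//|/fc].
- by have [xT xTin exT] := xTc; exists xT; rewrite // finset.setU1r.
- have [base [-> baseP]] := updateP (zT_undominated fx) tops' recN.
  have topsb : all (fun rg => rg.1 == zT) base.
    case: baseP => [->//|[bb [er _]]].
    by move: tops'; rewrite er all_rcons => /andP[].
  move=> rec0 rg0; rewrite -(cat_rcons (zT, z x)) cats1 => /rcons_inj[<- _].
  by rewrite all_rcons /= eqxx topsb; split=> //; case: (base).
exact: covers_frontier_update.
Qed.
End MainLoop.
End Algorithm.

Theorem theorem2 (R : realType) (I : instance R)
    (nonempty : exists x : solution I, feasible x)
    (route_fact : routes_are_concatenations I)
    (excess_fact : excess_is_additive I) :
  guaranteed (@returns_all_nondominated R I) (Start I).
Proof.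
have lex (g h : solution I -> R) : exists x, lexmin g h x.
  apply: finite_minimizer; have [x xmin] := finite_minimizer g nonempty.
  by exists x.
apply: guaranteed_later.
  have [xT xTmin] := lex (@z1 _ I) (@z2 _ I).
  have [xB xBmin] := lex (@z2 _ I) (@z1 _ I).
  by eexists; apply: step_init xTmin xBmin.
move=> c' st.
inversion st as [xT xB [[fT T1] T2] [[fB B2] _]| | | | | |]; subst.
have lexT (x : solution I) : feasible x -> z1 x <= z1 xT -> z2 xT <= z2 x.
  by move=> fx le; apply: T2; split=> // x' /T1; apply: le_trans.
(* Otherwise [xT], which minimizes [z1], would dominate [x]. *)
have topT (x : solution I) : efficient x -> z x = z xT \/ (z x).2 < (z xT).2.
  move=> [fx eff]; have [|le] := ltP (z x).2 (z xT).2; first by right.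
  left; apply: contrapT => ne; have [|| |] := @dominatesPn _ (z xT) (z x).
  - by apply/negP => dom; apply: eff; exists xT.
  - by move=> e; apply: ne.
  - by rewrite ltNge T1.
  by rewrite ltNge le.
apply: (guaranteed_loop route_fact excess_fact) => //.
- move=> x fx; apply/negP => /and3P[/= le1 le2 /orP[|]]; rewrite ltNge ?T1 //.
  by rewrite lexT.
- by move=> x; rewrite finset.in_set2 => /orP[] /eqP->.
- by exists xT; rewrite // finset.set21.
- by move=> [|? []] rg // [<-].
move=> x effx; have [e|ltT] := topT x effx.
  by left; exists xT; rewrite // finset.set21.
have [fx eff] := effx.
have [e|ne] := pselect (z xB = z x).
  by left; exists xB; rewrite // finset.set22.
right; exists (z xT, z xB); first exact: mem_head.
(* Since [xB] minimizes [z2] and does not dominate [x], the image of [x] is strictly smaller in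
   [z1]. *)
rewrite /in_region /= ltT B2 // !andbT.
have [|//|] := @dominatesPn _ (z xB) (z x) _ ne.
  by apply/negP => dom; apply: eff; exists xB.
by rewrite ltNge B2.
Qed.
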